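(* Let $\mathcal{R}$ be a $*$-ring of characteristic 2, let $\mathcal{V}$ be an indefinite inner product module (IIPM) over $\mathcal{R}$, and let $T:\mathcal{V}\to\mathcal{V}$ be a self-adjoint morphism. Then the morphism $$U:=\begin{pmatrix} T & I_{\mathcal{V}}+T\\ I_{\mathcal{V}}+T & T\end{pmatrix}$$ is unitary on $\mathcal{V}\oplus\mathcal{V}$, and $$T=P_{\mathcal{V}}U|_{\mathcal{V}},\qquad T^*=P_{\mathcal{V}}U^*|_{\mathcal{V}},$$ where $P_{\mathcal{V}}:\mathcal{V}\oplus\mathcal{V}\to\mathcal{V}$, $(x,y)\mapsto x$, and $|_{\mathcal{V}}$ denotes restriction to the first summand, i.e. to $\mathcal{V}\cong\{(x,0):x\in\mathcal{V}\}$.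
   Context: A $*$-ring is a ring $\mathcal{R}$ with an automorphism $*$ which is either the identity or of order 2. Characteristic 2 means $r+r=0$ for all $r\in\mathcal{R}$. A module $\mathcal{V}$ over $\mathcal{R}$ is an indefinite inner product module (IIPM) if it is equipped with a map $\langle\cdot,\cdot\rangle:\mathcal{V}\times\mathcal{V}\to\mathcal{R}$ such that: (i) if $x\in\mathcal{V}$ satisfies $\langle x,y\rangle=0$ for all $y\in\mathcal{V}$, then $x=0$; (ii) $\langle x,y\rangle=\langle y,x\rangle^*$ for all $x,y\in\mathcal{V}$; (iii) $\langle ax+y,z\rangle=a\langle x,z\rangle+\langle y,z\rangle$ for all $a\in\mathcal{R}$ and $x,y,z\in\mathcal{V}$. A morphism is an $\mathcal{R}$-module homomorphism; $I_{\mathcal{V}}$ is the identity on $\mathcal{V}$. A morphism $T:\mathcal{V}\to\mathcal{V}$ is adjointable if there is a morphism $T^*:\mathcal{V}\to\mathcal{V}$ with $\langle Tx,y\rangle=\langle x,T^*y\rangle$ for all $x,y\in\mathcal{V}$ (by (i), $T^*$ is unique if it exists). An adjointable morphism $T$ is self-adjoint if $T^*=T$. An adjointable morphism $U$ on an IIPM $\mathcal{W}$ is unitary if $UU^*=U^*U=I_{\mathcal{W}}$. The direct sum $\mathcal{V}\oplus\mathcal{V}$ is the IIPM with inner product $\langle(x_1,x_2),(y_1,y_2)\rangle=\langle x_1,y_1\rangle+\langle x_2,y_2\rangle$. Operator matrices act on column vectors in the usual way. *)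

(* Defs.v *)
From HB Require Import structures.
From mathcomp Require Import all_boot all_algebra boolp.

Set Implicit Arguments.
Unset Strict Implicit.
Unset Printing Implicit Defensive.

Import GRing.Theory.
Local Open Scope ring_scope.

(* Rings are unital, not assumed commutative, and the zero ring is allowed.
   [star] is an automorphism, not an anti-automorphism. *)
HB.mixin Record PzRing_isStarRing R of GRing.PzRing R := {
  star : {rmorphism R -> R};
  star_bij : bijective star;
  star_order : star =1 id \/ (~ star =1 id /\ star \o star =1 id)
}.

#[short(type="starRingType")]
HB.structure Definition StarRing :=
  {R of GRing.PzRing R & PzRing_isStarRing R}.

HB.mixin Record Lmodule_isIIPM (R : starRingType) V of GRing.Lmodule R V := {
  inner : V -> V -> R;
  inner_nondeg : forall x : V, (forall y : V, inner x y = 0) -> x = 0;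
  inner_star : forall x y : V, inner x y = star (inner y x);
  innerP : forall (a : R) (x y z : V),
    inner (a *: x + y) z = a * inner x z + inner y z
}.

#[short(type="iipmType")]
HB.structure Definition IIPM (R : starRingType) :=
  {V of GRing.Lmodule R V & Lmodule_isIIPM R V}.

Section Inner.
Variables (R : starRingType) (V : iipmType R).
Implicit Types x y z : V.

Lemma innerDl x y z : inner (x + y) z = inner x z + inner y z.
Proof. by rewrite -{1}[x]scale1r innerP mul1r. Qed.

Lemma inner0l z : inner (0 : V) z = 0.
Proof. by apply: (@addIr _ (inner (0 : V) z)); rewrite -innerDl !add0r. Qed.

Lemma innerNl x z : inner (- x) z = - inner x z.
Proof. by apply: (@addIr _ (inner x z)); rewrite -innerDl !addNr inner0l. Qed.

Lemma innerDr x y z : inner x (y + z) = inner x y + inner x z.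
Proof. by rewrite inner_star innerDl rmorphD -!inner_star. Qed.

Lemma inner0r x : inner x (0 : V) = 0.
Proof. by rewrite inner_star inner0l rmorph0. Qed.

End Inner.

Section DirectSum.
Variables (R : starRingType) (V W : iipmType R).

Definition pair_inner (u v : V * W) : R := inner u.1 v.1 + inner u.2 v.2.

Fact pair_inner_nondeg u : (forall v, pair_inner u v = 0) -> u = 0.
Proof.
case: u => x y h; congr (_, _); apply: inner_nondeg => z.
  by have := h (z, 0); rewrite /pair_inner /= inner0r addr0.
by have := h (0, z); rewrite /pair_inner /= inner0r add0r.
Qed.

Fact pair_inner_star u v : pair_inner u v = star (pair_inner v u).
Proof. by rewrite /pair_inner rmorphD -!inner_star. Qed.

Fact pair_innerP a u v w :
  pair_inner (a *: u + v) w = a * pair_inner u w + pair_inner v w.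
Proof. by rewrite /pair_inner /= !innerP mulrDr addrACA. Qed.

HB.instance Definition _ := Lmodule_isIIPM.Build R (V * W)%type
  pair_inner_nondeg pair_inner_star pair_innerP.

End DirectSum.

Section Adjoint.
Variables (R : starRingType) (V : iipmType R).
Implicit Types S T : {linear V -> V}.

Definition is_adjoint T S := forall x y : V, inner (T x) y = inner x (S y).

Definition adjointable T := exists S, is_adjoint T S.

Lemma is_adjoint_unique T S S' : is_adjoint T S -> is_adjoint T S' -> S =1 S'.
Proof.
move=> hS hS' y; apply/eqP; rewrite -subr_eq0; apply/eqP.
apply: inner_nondeg => x; rewrite innerDl innerNl.
by rewrite !(inner_star _ x) -hS -hS' subrr.
Qed.

(* The junk value for a non-adjointable T is 0. *)
Definition adjoint T : {linear V -> V} :=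
  if pselect (adjointable T) is left h then projT1 (cid h) else \0.

Lemma adjointP T : adjointable T -> is_adjoint T (adjoint T).
Proof. by rewrite /adjoint; case: pselect => // h _; case: cid. Qed.

Definition self_adjoint T := adjointable T /\ adjoint T =1 T.

Definition unitary T :=
  [/\ adjointable T, T \o adjoint T =1 idfun & adjoint T \o T =1 idfun].

End Adjoint.

Section OperatorMatrix.
Variables (R : starRingType) (V : iipmType R) (A B C D : {linear V -> V}).

(* The operator matrix with rows (A B) and (C D). *)
Definition op_block_mx (u : V * V) : V * V :=
  (A u.1 + B u.2, C u.1 + D u.2).

Fact op_block_mx_is_linear : linear op_block_mx.
Proof.
by move=> a u v; congr (_, _); rewrite /= !linearP scalerDr addrACA.
Qed.

HB.instance Definition _ := GRing.isLinear.Build R (V * V)%type (V * V)%type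
  *:%R op_block_mx op_block_mx_is_linear.

End OperatorMatrix.

Section Dilation.
Variables (R : starRingType) (V : iipmType R).

Definition dilation (T : {linear V -> V}) : {linear (V * V)%type -> (V * V)%type} :=
  op_block_mx T (idfun \+ T) (idfun \+ T) T.

Definition proj_fst (u : V * V) : V := u.1.

Definition restrict_fst (S : V * V -> V * V) (x : V) : V * V := S (x, 0).

End Dilation.

(* Main.v *)
Require Import Defs.
From mathcomp Require Import all_boot all_algebra.

Set Implicit Arguments.
Unset Strict Implicit.
Unset Printing Implicit Defensive.

Import GRing.Theory.
Local Open Scope ring_scope.

(* With s = x + y we have U (x, y) = (T s + y, T s + x). In characteristic 2 the
   two entries of U (x, y) again add up to s, so U is an involution; being
   self-adjoint as well, it is unitary. *)

(** Both U and T equal their adjoints, so unitarity reduces to U being an involution, and the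
    compression of the adjoint reduces to that of U. *)

(** Exhibiting [S] makes [T] adjointable, so [adjoint T] is not the default 0; nondegeneracy then
    forces it to agree with [S]. *)
Lemma is_adjoint_adjoint (R : starRingType) (V : iipmType R)
    (T S : {linear V -> V}) : is_adjoint T S -> adjoint T =1 S.
Proof.
move=> TS; apply: (is_adjoint_unique _ TS).
by apply: adjointP; exists S.
Qed.

Lemma dilationE (R : starRingType) (V : iipmType R) (T : {linear V -> V})
    (u : V * V) :
  dilation T u = (T (u.1 + u.2) + u.2, T (u.1 + u.2) + u.1).
Proof.
rewrite /= /op_block_mx /= !linearD; congr (_, _).
  by rewrite -addrA [u.2 + _]addrC.
by rewrite -addrA addrC.
Qed.

(** With s and t the sums of the entries of [u] and [v], the left side is [inner (T s) t + inner u.2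
    v.1 + inner u.1 v.2]. Moving [T] onto t gives the right side, with the cross terms swapped. *)
Lemma is_adjoint_dilation (R : starRingType) (V : iipmType R)
    (T : {linear V -> V}) : is_adjoint T T -> is_adjoint (dilation T) (dilation T).
Proof.
move=> TT u v; rewrite !dilationE.
rewrite [LHS]/(pair_inner _ _) [RHS]/(pair_inner _ _) /pair_inner /=.
rewrite !innerDl addrACA -innerDr TT innerDl !innerDr [RHS]addrACA.
by rewrite [inner u.2 v.1 + _]addrC.
Qed.

Lemma dilation_involutive (R : starRingType) (char2 : forall r : R, r + r = 0)
    (V : iipmType R) (T : {linear V -> V}) : involutive (dilation T).
Proof.
(* Characteristic 2 passes from scalars to vectors through 1 + 1 = 0. *)
have addvv (x : V) : x + x = 0 by rewrite -[x]scale1r -scalerDl char2 scale0r.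
move=> [x y]; rewrite !dilationE /= addrACA addvv add0r [y + x]addrC.
by rewrite !addrA addvv !add0r.
Qed.

Theorem theorem2p2 (R : starRingType) (char2 : forall r : R, r + r = 0)
    (V : iipmType R) (T : {linear V -> V}) (T_sa : self_adjoint T) :
  [/\ unitary (dilation T),
      T =1 @proj_fst R V \o restrict_fst (dilation T)
    & adjoint T =1 @proj_fst R V \o restrict_fst (adjoint (dilation T))].
Proof.
case: T_sa => T_adj T_sa.
have TT : is_adjoint T T by move=> x y; rewrite (adjointP T_adj) T_sa.
have UU := is_adjoint_dilation TT.
have UE := is_adjoint_adjoint UU.
have U2 := dilation_involutive char2 T.
have compr : T =1 @proj_fst R V \o restrict_fst (dilation T).
  (* At (x, 0) the sum s is x, and the first entry T s + 0 is T x. *)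
  by move=> x; rewrite [RHS]/((dilation T (x, 0)).1) dilationE /= !addr0.
split=> //.
  split; first by exists (dilation T).
    (* [UE] turns the adjoint into U, leaving U applied twice. *)
    by move=> u; exact: etrans (congr1 (dilation T) (UE u)) (U2 u).
  by move=> u; exact: etrans (UE (dilation T u)) (U2 u).
by move=> x; rewrite T_sa; exact: etrans (compr x) (congr1 fst (esym (UE (x, 0)))).
Qed.
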